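(* Let $((E^n,\|\cdot\|_n):n\in\mathbb N)$ and $((F^n,\|\cdot\|_n):n\in\mathbb N)$ be multi-normed spaces, with $F$ a Banach space. Then $(\mathcal M(E,F),\|\cdot\|_{mb})$ is a Banach space. Further: (i) $y_0\otimes\lambda_0\in\mathcal M(E,F)$ with $\|y_0\otimes\lambda_0\|_{mb}=\|y_0\|\,\|\lambda_0\|=\|y_0\otimes\lambda_0\|$ for each $\lambda_0\in E'$ and $y_0\in F$; (ii) $\mathcal N(E,F)\subset\mathcal M(E,F)$, and the natural embedding (of $\mathcal N(E,F)$ with the nuclear norm into $(\mathcal M(E,F),\|\cdot\|_{mb})$) is a contraction.
   Context: All spaces are complex. A multi-norm based on a normed space $(E,\|\cdot\|)$ is a sequence $(\|\cdot\|_k:k\in\mathbb N)$, with $\|\cdot\|_k$ a norm on $E^k$ and $\|x\|_1=\|x\|$, such that for each $k\ge2$: (A1) $\|(x_{\sigma(1)},\dots,x_{\sigma(k)})\|_k=\|(x_1,\dots,x_k)\|_k$ for each permutation $\sigma$ of $\{1,\dots,k\}$; (A2) $\|(\alpha_1x_1,\dots,\alpha_kx_k)\|_k\le(\max_i|\alpha_i|)\|(x_1,\dots,x_k)\|_k$ for $\alpha_i\in\mathbb C$; (A3) $\|(x_1,\dots,x_{k-1},0)\|_k=\|(x_1,\dots,x_{k-1})\|_{k-1}$; (A4) $\|(x_1,\dots,x_{k-2},x_{k-1},x_{k-1})\|_k=\|(x_1,\dots,x_{k-1})\|_{k-1}$, for all $x_i\in E$. Then $((E^n,\|\cdot\|_n):n\in\mathbb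 N)$ is a multi-normed space. A subset $B$ of $E$ is multi-bounded if $c_B:=\sup\{\|(x_1,\dots,x_n)\|_n:x_1,\dots,x_n\in B,\ n\in\mathbb N\}<\infty$. A linear map $T:E\to F$ between multi-normed spaces is multi-bounded if $T(B)$ is multi-bounded in $F$ for each multi-bounded $B\subset E$; $\mathcal M(E,F)$ is the linear space of such maps, and $\|T\|_{mb}=\sup\{c_{T(B)}:B\subset E\text{ multi-bounded},\ c_B\le1\}$ (which is finite). For $\lambda_0\in E'$ and $y_0\in F$, $y_0\otimes\lambda_0$ is the operator $x\mapsto\langle x,\lambda_0\rangle y_0$. A bounded operator $T:E\to F$ is nuclear if $T=\sum_{i=1}^\infty y_i\otimes\lambda_i$ with $\lambda_i\in E'$, $y_i\in F$ and $\sum_i\|y_i\|\|\lambda_i\|<\infty$; its nuclear norm $\nu(T)$ is the infimum of such sums. $\mathcal N(E,F)$ is the space of nuclear operators. $\|\cdot\|$ on operators is the operator norm. *)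

(* Defs.v *)
From HB Require Import structures.
From mathcomp Require Import all_boot all_order all_algebra all_fingroup.
From mathcomp Require Import complex.
From mathcomp Require Import all_classical all_reals all_analysis.

Set Implicit Arguments.
Unset Strict Implicit.
Unset Printing Implicit Defensive.

Import Order.TTheory GRing.Theory Num.Theory.
Import numFieldNormedType.Exports.

Local Open Scope classical_set_scope.
Local Open Scope ring_scope.
Local Open Scope complex_scope.

(* The library norm of a complex normed space takes its values in [R[i]], on
   the nonnegative real axis; [rnorm] is the same number as an element of [R].
   Scalars are seen as the normed space [R[i]^o]. *)
Definition rnorm (R : realType) (V : normedModType R[i]) (x : V) : R :=
  complex.Re `|x|.

Definition cabs (R : realType) (a : R[i]) : R := complex.Re `|a|.

Record is_norm_on (R : realType) (V : lmodType R[i])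
    (D : set V) (N : V -> R) : Prop := IsNormOn {
  norm_on_ge0 : forall x, D x -> 0 <= N x;
  norm_on_eq0 : forall x, D x -> N x = 0 -> x = 0;
  norm_onZ : forall (a : R[i]) x, D x -> N (a *: x) = cabs a * N x;
  norm_onD : forall x y, D x -> D y -> N (x + y) <= N x + N y
}.

(* The linear subspace [D] of [V], with the norm [N], is a Banach space (the
   values of [N] outside [D] are irrelevant). *)
Definition is_banach_on (R : realType) (V : lmodType R[i])
    (D : set V) (N : V -> R) : Prop :=
  [/\ submod_closed [in D],
      is_norm_on D N
    & forall u : nat -> V, (forall n, D (u n)) ->
        (forall e : R, 0 < e -> exists n0 : nat, forall m n : nat,
          (n0 <= m)%N -> (n0 <= n)%N -> N (u m - u n) < e) ->
        exists2 l : V, D l & N (u n - l) @[n --> \oo] --> (0 : R)].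

Definition ffun_rcons (T : Type) (k : nat) (x : {ffun 'I_k -> T}) (z : T) :
    {ffun 'I_k.+1 -> T} :=
  [ffun i => if unlift ord_max i is Some j then x j else z].

(* [E^k] is [{ffun 'I_k -> E}].  The index [k] ranges over all of [nat]: the
   space [E^0] is zero, so its norm is forced to be 0 and the axioms hold
   automatically when they involve it; the data are those for [k >= 1].
   With [k = 0] included, the suprema [mb_const] below are never suprema of an
   empty set. *)
Record multinorm (R : realType) (E : normedModType R[i]) := Multinorm {
  mnorm :> forall k : nat, {ffun 'I_k -> E} -> R;
  mnorm_norm : forall k, is_norm_on setT (@mnorm k);
  mnorm_base : forall x : E, @mnorm 1 [ffun=> x] = rnorm x;
  mnorm_A1 : forall k (s : {perm 'I_k}) (x : {ffun 'I_k -> E}),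
    @mnorm k [ffun i => x (s i)] = @mnorm k x;
  mnorm_A2 : forall k (a : 'I_k -> R[i]) (x : {ffun 'I_k -> E}),
    @mnorm k [ffun i => a i *: x i] <=
      (\big[Num.max/0]_(i < k) cabs (a i)) * @mnorm k x;
  mnorm_A3 : forall k (x : {ffun 'I_k -> E}),
    @mnorm k.+1 (ffun_rcons x 0) = @mnorm k x;
  mnorm_A4 : forall k (x : {ffun 'I_k.+1 -> E}),
    @mnorm k.+2 (ffun_rcons x (x ord_max)) = @mnorm k.+1 x
}.

(* the constant c_B, possibly infinite *)
Definition mb_const (R : realType) (E : normedModType R[i]) (mE : multinorm E)
    (B : set E) : \bar R :=
  ereal_sup [set z | exists n (x : {ffun 'I_n -> E}),
    (forall i, B (x i)) /\ z = (mE n x)%:E].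

Definition multi_bounded (R : realType) (E : normedModType R[i])
    (mE : multinorm E) (B : set E) : Prop :=
  (mb_const mE B < +oo)%E.

(* M(E, F) *)
Definition mb_op (R : realType) (E F : normedModType R[i])
    (mE : multinorm E) (mF : multinorm F) : set (E -> F) :=
  [set T | linear T /\
    forall B : set E, multi_bounded mE B -> multi_bounded mF (T @` B)].

Definition mb_norm (R : realType) (E F : normedModType R[i])
    (mE : multinorm E) (mF : multinorm F) (T : E -> F) : \bar R :=
  ereal_sup [set mb_const mF (T @` B) |
    B in [set B | multi_bounded mE B /\ (mb_const mE B <= 1)%E]].

Definition bounded_op (R : realType) (E F : normedModType R[i]) :
    set (E -> F) :=
  [set T | linear T /\ continuous T].

Definition dual (R : realType) (E : normedModType R[i]) : set (E -> R[i]^o) :=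
  @bounded_op R E R[i]^o.

Definition op_norm (R : realType) (E F : normedModType R[i]) (T : E -> F) :
    \bar R :=
  ereal_sup [set (rnorm (T x))%:E | x in [set x | rnorm x <= 1]].

Definition rank_one (R : realType) (E F : normedModType R[i])
    (y : F) (l : E -> R[i]^o) : E -> F :=
  fun x => l x *: y.

Definition nuclear_sum (R : realType) (E F : normedModType R[i])
    (y : nat -> F) (l : nat -> E -> R[i]^o) : \bar R :=
  (\sum_(0 <= i <oo) (rnorm (y i))%:E * op_norm (l i))%E.

(* [T] is the sum of the operators [rank_one (y i) (l i)], the series
   converging in the operator norm. *)
Definition nuclear_rep (R : realType) (E F : normedModType R[i])
    (T : E -> F) (y : nat -> F) (l : nat -> E -> R[i]^o) : Prop :=
  [/\ forall i, dual (l i),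
      (nuclear_sum y l < +oo)%E
    & op_norm (T - \sum_(0 <= i < n) rank_one (y i) (l i)) @[n --> \oo]
        --> (0 : \bar R)%E].

Definition nuclear (R : realType) (E F : normedModType R[i]) : set (E -> F) :=
  [set T | bounded_op T /\ exists y l, nuclear_rep T y l].

Definition nuclear_norm (R : realType) (E F : normedModType R[i])
    (T : E -> F) : \bar R :=
  ereal_inf [set z | exists y l, nuclear_rep T y l /\ z = nuclear_sum y l].

(* Main.v *)
(** Every operator [T] satisfies [op_norm T <= mb_norm T], because singletons
    have [c_{x} = |x|], and [T] is multi-bounded as soon as it is linear with
    [mb_norm T] finite, by scaling. Conversely, [mb_norm T] is finite by a
    gliding hump: were there sets [B_n] with [c_{B_n} <= 1] and
    [c_{T(B_n)} > 4^n], the union of the [2^-n B_n] would be multi-bounded, by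
    splitting a tuple according to the [n] of each entry, whereas its image
    under [T] would not. Completeness and the nuclear case are limits of bounds
    on fixed tuples: on [F^k], pointwise convergence gives convergence in the
    [k]-th norm because it is at most the sum of the norms of the entries. For
    [y (x) l], axiom (A2) applied to the constant tuple [y] with coefficients
    [l x_i] gives [mb_norm <= |y| |l|]. *)
Require Import Defs.
From HB Require Import structures.
From mathcomp Require Import all_boot all_order all_algebra all_fingroup.
From mathcomp Require Import complex.
From mathcomp Require Import all_classical all_reals all_analysis.
From mathcomp Require Import lra.
Import Order.TTheory GRing.Theory Num.Theory.
Import numFieldNormedType.Exports.
Local Open Scope classical_set_scope.
Local Open Scope ring_scope.
Local Open Scope complex_scope.

Set Implicit Arguments.
Unset Strict Implicit.

(** * Real-valued norms on complex normed spaces *)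

Lemma normr_rnorm {R : realType} {V : normedModType R[i]} (x : V) :
  `|x| = (rnorm x)%:C.
Proof. by rewrite /rnorm RRe_real ?ger0_real. Qed.

Lemma normr_cabs {R : realType} (a : R[i]) : `|a| = (cabs a)%:C.
Proof. by rewrite /cabs RRe_real ?ger0_real. Qed.

Lemma rnorm_ge0 {R : realType} {V : normedModType R[i]} (x : V) : 0 <= rnorm x.
Proof. by rewrite -lecR -normr_rnorm normr_ge0. Qed.

Lemma cabs_ge0 {R : realType} (a : R[i]) : 0 <= cabs a.
Proof. by rewrite -lecR -normr_cabs normr_ge0. Qed.

Lemma cabs_real {R : realType} (a : R) : 0 <= a -> cabs a%:C = a.
Proof. by move=> a0; apply: complexI; rewrite -normr_cabs ger0_norm ?ler0c. Qed.

Lemma cabs0 {R : realType} : cabs (0 : R[i]) = 0.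
Proof. by rewrite cabs_real. Qed.

Lemma cabsV {R : realType} (a : R[i]) : cabs a^-1 = (cabs a)^-1.
Proof. by apply: complexI; rewrite -normr_cabs normfV normr_cabs fmorphV. Qed.

Lemma cabs_eq0 {R : realType} (a : R[i]) : (cabs a == 0) = (a == 0).
Proof. by rewrite -(inj_eq (@complexI R)) -normr_cabs normr_eq0. Qed.

Lemma rnormZ {R : realType} {V : normedModType R[i]} (a : R[i]) (x : V) :
  rnorm (a *: x) = cabs a * rnorm x.
Proof.
by apply: complexI; rewrite rmorphM /= -!normr_rnorm -normr_cabs normrZ.
Qed.

Lemma rnormN {R : realType} {V : normedModType R[i]} (x : V) :
  rnorm (- x) = rnorm x.
Proof. by rewrite /rnorm normrN. Qed.

Lemma rnorm_eq0 {R : realType} {V : normedModType R[i]} (x : V) :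
  (rnorm x == 0) = (x == 0).
Proof. by rewrite -(inj_eq (@complexI R)) -normr_rnorm normr_eq0. Qed.

(** Operators here are bare functions with a proof of linearity; a bundled copy makes [linearZ] and
    [linear0] applicable to them. *)
Lemma linear_lift {K : pzRingType} {U V : lmodType K} (f : U -> V) :
  linear f -> exists g : {linear U -> V}, f = g.
Proof.
move=> lf; pose g : {linear U -> V} := HB.pack f (GRing.isLinear.Build _ _ _ _ f lf).
by exists g.
Qed.

(** * Multi-norms of tuples and the constants of sets *)

Section Mnorm.
Context {R : realType} {E : normedModType R[i]} (mE : multinorm E).
Implicit Types (B : set E) (k : nat).

Let nE k := mnorm_norm mE k.

Lemma mnorm_ge0 k (x : {ffun 'I_k -> E}) : 0 <= mE k x.
Proof. exact: norm_on_ge0 (nE k) _ _. Qed.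

Lemma mnormZ k a (x : {ffun 'I_k -> E}) : mE k (a *: x) = cabs a * mE k x.
Proof. exact: norm_onZ (nE k) _ _ _. Qed.

Lemma mnormD k (x y : {ffun 'I_k -> E}) : mE k (x + y) <= mE k x + mE k y.
Proof. exact: norm_onD (nE k) _ _ _ _. Qed.

Lemma mnorm0 k : mE k 0 = 0.
Proof. by rewrite -(scale0r 0) mnormZ cabs0 mul0r. Qed.

Lemma mnorm_sum k (I : Type) (r : seq I) (f : I -> {ffun 'I_k -> E}) :
  mE k (\sum_(i <- r) f i) <= \sum_(i <- r) mE k (f i).
Proof.
elim/big_ind2: _ => [|x a y b xa yb|//]; first by rewrite mnorm0.
by apply: (le_trans (mnormD _ _)); apply: lerD.
Qed.

Lemma mnorm_scale_le k (a : 'I_k -> R[i]) (x : {ffun 'I_k -> E}) (c : R) :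
  0 <= c -> (forall i, cabs (a i) <= c) ->
  mE k [ffun i => a i *: x i] <= c * mE k x.
Proof.
move=> c0 ac; apply: (le_trans (mnorm_A2 mE a x)).
by rewrite ler_wpM2r ?mnorm_ge0//; apply: bigmax_le.
Qed.

(** By induction, (A4) strips the repeated last entry until only the norm on E^1 is left. *)
Lemma mnorm_const k (x : E) : mE k.+1 [ffun=> x] = rnorm x.
Proof.
elim: k => [|k IHk]; first exact: mnorm_base.
rewrite -IHk -[RHS]mnorm_A4; congr (mnorm _ _); apply/ffunP => i.
by rewrite !ffunE; case: unlift => [j|//]; rewrite ffunE.
Qed.

(** Only an inequality, since for [k = 0] the left side is 0 whatever [x] is. *)
Lemma mnorm_const_le k (x : E) : mE k [ffun=> x] <= rnorm x.
Proof.
case: k => [|k]; last by rewrite mnorm_const.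
by rewrite (_ : [ffun=> x] = 0) ?mnorm0 ?rnorm_ge0//; apply/ffunP => -[].
Qed.

Lemma mnorm_mask_le k (p : pred 'I_k) (x : {ffun 'I_k -> E}) :
  mE k [ffun i => (p i)%:R *: x i] <= mE k x.
Proof.
rewrite -[leRHS]mul1r; apply: mnorm_scale_le => // i.
by case: (p i); rewrite ?cabs0// cabs_real.
Qed.

(** A tuple is the sum of its single-entry parts. Each part is a constant tuple masked by
    coefficients 0 and 1, so (A2) and (A4) bound it by the norm of the entry. *)
Lemma mnorm_le_sum k (x : {ffun 'I_k -> E}) :
  mE k x <= \sum_(i < k) rnorm (x i).
Proof.
have {1}-> : x = \sum_(i < k) [ffun j => (j == i)%:R *: [ffun=> x i] j].
  apply/ffunP => j; rewrite sum_ffunE (bigD1 j)//= big1 ?addr0.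
    by rewrite !ffunE eqxx scale1r.
  by move=> i ij; rewrite !ffunE eq_sym (negPf ij) scale0r.
rewrite (le_trans (mnorm_sum _ _))//; apply: ler_sum => i _.
exact: le_trans (mnorm_mask_le _ _) (mnorm_const_le _ _).
Qed.

(** The form in which pointwise estimates enter the limit arguments. Dividing by [k.+1] rather than
    [k] keeps the threshold positive when [k = 0]. *)
Lemma mnorm_le_coord k (x : {ffun 'I_k -> E}) (d : R) : 0 < d ->
  (forall i, rnorm (x i) <= d / k.+1%:R) -> mE k x <= d.
Proof.
move=> d0 xd; apply: (le_trans (mnorm_le_sum _)).
apply: (@le_trans _ _ (\sum_(i < k) d / k.+1%:R)); first exact: ler_sum.
rewrite sumr_const card_ord -[leLHS]mulr_natr -mulrA ler_piMr ?(ltW d0)//.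
by rewrite mulrC ler_pdivrMr// mul1r ler_nat.
Qed.

Lemma mb_constP B (c : R) : (mb_const mE B <= c%:E)%E <->
  forall k (x : {ffun 'I_k -> E}), (forall i, B (x i)) -> mE k x <= c.
Proof.
split=> [Bc k x Bx|Bc].
  rewrite -lee_fin (le_trans _ Bc)//; apply: ereal_sup_ubound.
  by exists k, x.
by apply: ge_ereal_sup => _ [k [x [Bx ->]]]; rewrite lee_fin Bc.
Qed.

Lemma mb_const_ge0 B : (0 <= mb_const mE B)%E.
Proof.
apply: ereal_sup_ubound; exists 0, 0; split; first by case.
by rewrite mnorm0.
Qed.

Lemma multi_boundedP B : multi_bounded mE B <->
  exists2 c : R, 0 < c & (mb_const mE B <= c%:E)%E.
Proof.
split=> [|[c _ Bc]]; last exact: le_lt_trans Bc (ltry c).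
rewrite /multi_bounded; have := mb_const_ge0 B.
case: mb_const => [r|//|//]; rewrite lee_fin => r0 _.
by exists (r + 1); rewrite ?lee_fin ?lerDl// ltr_wpDl.
Qed.

Lemma mb_const_set1 (x : E) : (mb_const mE [set x] <= (rnorm x)%:E)%E.
Proof.
apply/mb_constP => k y yx; rewrite (_ : y = [ffun=> x]) ?mnorm_const_le//.
by apply/ffunP => i; rewrite yx ffunE.
Qed.

Lemma rnorm_le_mb_const B (c : R) x :
  (mb_const mE B <= c%:E)%E -> B x -> rnorm x <= c.
Proof.
move=> /mb_constP Bc Bx; rewrite -(mnorm_base mE).
by apply: Bc => i; rewrite ffunE.
Qed.

Lemma mb_const_scale B (a : R[i]) (c : R) : (mb_const mE B <= c%:E)%E ->
  (mb_const mE [set a *: x | x in B] <= (cabs a * c)%:E)%E.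
Proof.
move=> /mb_constP Bc; apply/mb_constP => k y By.
have {}By i : exists x, B x /\ a *: x = y i by have [x] := By i; exists x.
have [x xP] := choice By.
have -> : y = a *: [ffun i => x i].
  by apply/ffunP => i; rewrite !ffunE; case: (xP i).
rewrite mnormZ ler_wpM2l ?cabs_ge0// Bc// => i; rewrite ffunE.
by case: (xP i).
Qed.

Lemma mnorm_mask_mb_const B (c : R) k (p : pred 'I_k) (x : {ffun 'I_k -> E}) :
  (mb_const mE B <= c%:E)%E -> (forall i, p i -> B (x i)) ->
  mE k [ffun i => (p i)%:R *: x i] <= c.
Proof.
(* Entries outside [p] can be replaced by any element of [B] before masking. *)
move=> Bc Bx; have c0 : 0 <= c.
  by rewrite -lee_fin (le_trans (mb_const_ge0 B)).
have [/existsP[j pj]|/existsPn np] := boolP [exists i, p i]; last first.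
  rewrite (_ : finfun _ = 0) ?mnorm0//.
  by apply/ffunP => i; rewrite !ffunE (negPf (np i)) scale0r.
pose y := [ffun i => if p i then x i else x j].
rewrite (_ : finfun _ = [ffun i => (p i)%:R *: y i]); last first.
  by apply/ffunP => i; rewrite !ffunE; case: (p i); rewrite ?scale0r.
rewrite (le_trans (mnorm_mask_le _ _))//.
move/mb_constP: Bc; apply=> i; rewrite ffunE.
by have [pi|_] := boolP (p i); apply: Bx.
Qed.

Lemma mb_const_bigcup (B : nat -> set E) :
  (forall n, (mb_const mE (B n) <= 1)%E) ->
  (mb_const mE (\bigcup_n [set (2 ^- n)%:C *: x | x in B n]) <= 2%:E)%E.
Proof.
move=> B1; apply/mb_constP => k y By.
have {}By i : exists nx : nat * E, B nx.1 nx.2 /\ y i = (2 ^- nx.1)%:C *: nx.2.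
  by have [n _ [x Bx <-]] := By i; exists (n, x).
have [nx nxP] := choice By.
(* The successor puts every index that occurs in the tuple strictly below [N]. *)
pose N := (\max_i (nx i).1).+1.
(* Entries are grouped by index; [mnorm_mask_mb_const] will bound the group of index [n] by 1,
   before the factor 2^-n. *)
have -> : y = \sum_(n < N)
    (2 ^- n)%:C *: [ffun i => ((nx i).1 == n)%:R *: [ffun j => (nx j).2] i].
  apply/ffunP => i; have ltN : ((nx i).1 < N)%N by rewrite ltnS leq_bigmax.
  rewrite sum_ffunE (bigD1 (Ordinal ltN))//= big1 ?addr0 => [|n].
    by rewrite !ffunE eqxx scale1r; case: (nxP i).
  by rewrite -val_eqE/= eq_sym => nN; rewrite !ffunE (negPf nN) scale0r scaler0.
rewrite (le_trans (mnorm_sum _ _))//.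
have e0 n : 0 <= 2 ^- n :> R by rewrite invr_ge0 exprn_ge0.
apply: (@le_trans _ _ (\sum_(n < N) 2 ^- n)).
  apply: ler_sum => n _; rewrite mnormZ cabs_real// ler_piMr//.
  apply: (mnorm_mask_mb_const (B1 n)) => i /eqP <-; rewrite ffunE.
  by case: (nxP i).
(* The closed form of the geometric sum explains the constant 2. *)
suff -> : \sum_(n < N) 2 ^- n = 2 - 2 * 2 ^- N :> R.
  by rewrite lerBlDr lerDl mulr_ge0.
elim: N => [|N IHN]; first by rewrite big_ord0 expr0 invr1 mulr1 subrr.
rewrite big_ord_recr/= IHN [2 ^+ N.+1]exprS invfM.
have : 2 ^+ N != 0 :> R by rewrite expf_neq0.
by move=> _; lra.
Qed.

End Mnorm.

(** * Multi-bounded operators and their norm *)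

Section Operators.
Context {R : realType} {E F : normedModType R[i]}.
Context (mE : multinorm E) (mF : multinorm F).
Implicit Types (T S : E -> F).

(** Reduces the two nested suprema to single tuples: the entries of a tuple in the image of [B] get
    preimages chosen inside [B]. *)
Lemma mb_norm_le T (c : \bar R) :
  (forall (B : set E) k (x : {ffun 'I_k -> E}),
    (mb_const mE B <= 1)%E -> (forall i, B (x i)) ->
    ((mF k [ffun i => T (x i)])%:E <= c)%E) ->
  (mb_norm mE mF T <= c)%E.
Proof.
move=> Tc; apply: ge_ereal_sup => _ [B [_ B1] <-].
apply: ge_ereal_sup => _ [k [y [yB ->]]].
have {}yB i : exists x, B x /\ T x = y i by have [x] := yB i; exists x.
have [x xP] := choice yB.
have -> : y = [ffun i => T ([ffun j => x j] i)].
  by apply/ffunP => i; rewrite !ffunE; case: (xP i).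
by apply: (Tc B) => // i; rewrite ffunE; case: (xP i).
Qed.

Lemma mnorm_le_mb_norm T (B : set E) k (x : {ffun 'I_k -> E}) :
  (mb_const mE B <= 1)%E -> (forall i, B (x i)) ->
  ((mF k [ffun i => T (x i)])%:E <= mb_norm mE mF T)%E.
Proof.
move=> B1 Bx; apply: (@le_trans _ _ (mb_const mF (T @` B))).
  apply: ereal_sup_ubound; exists k, [ffun i => T (x i)]; split=> // i.
  by rewrite ffunE; exists (x i).
apply: ereal_sup_ubound; exists B => //; split=> //.
by apply/multi_boundedP; exists 1.
Qed.

(** The empty set is the witness: its only tuple is the empty one, of norm 0. *)
Lemma mb_norm_ge0 T : (0 <= mb_norm mE mF T)%E.
Proof.
have := @mnorm_le_mb_norm T set0 0 [ffun=> 0].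
rewrite (_ : [ffun i => T _] = 0) ?mnorm0; last by apply/ffunP => -[].
apply; last by case.
by apply/mb_constP => -[x _|k x /(_ ord0)//]; rewrite (_ : x = 0) ?mnorm0//;
  apply/ffunP => -[].
Qed.

Lemma op_norm_le_mb_norm T : (op_norm T <= mb_norm mE mF T)%E.
Proof.
apply: ge_ereal_sup => _ [x x1 <-].
have := @mnorm_le_mb_norm T [set x] 1 [ffun=> x].
rewrite (_ : [ffun i => T _] = [ffun=> T x]) ?mnorm_base; last first.
  by apply/ffunP => i; rewrite !ffunE.
apply=> [|i]; last by rewrite ffunE.
by rewrite (le_trans (mb_const_set1 _ _)).
Qed.

Lemma mb_norm_lty T : mb_op mE mF T -> (mb_norm mE mF T < +oo)%E.
Proof.
move=> [/linear_lift[f ->{T}] fb]; apply: contrapT => Too.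
have /choice[B BP] (n : nat) : exists B : set E, (mb_const mE B <= 1)%E /\
    exists k (x : {ffun 'I_k -> E}), (forall i, B (x i)) /\
      4 ^+ n < mF k [ffun i => f (x i)].
  (* If no set worked for [n], then 4^n would bound [mb_norm]. *)
  apply: contrapT => nB; apply: Too.
  apply: (le_lt_trans _ (ltry (4 ^+ n))); apply: mb_norm_le => B k x B1 Bx.
  rewrite lee_fin leNgt; apply/negP => xn; apply: nB.
  by exists B; split=> //; exists k, x.
set U := \bigcup_n [set (2 ^- n)%:C *: x | x in B n].
have /fb/multi_boundedP[c c0 /mb_constP fU] : multi_bounded mE U.
  by apply/multi_boundedP; exists 2 => //; apply: mb_const_bigcup => n; case: (BP n).
(* This [n] exceeds [c]. The tuple from [B n], scaled by 2^-n, has its image in that of [U], so 4^n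
   < 2^n c, whence 2^n < c < n, which is absurd. *)
have := archi_boundP (ltW c0); set n := Num.bound c.
have [_ [k [x [Bx]]]] := BP n.
have := fU k ((2 ^- n)%:C *: [ffun i => f (x i)]).
have e0 : 0 < 2 ^+ n :> R by rewrite exprn_gt0.
rewrite mnormZ cabs_real ?invr_ge0 ?(ltW e0)// ler_pdivrMl// => fxc.
have {}fxc : mF k [ffun i => f (x i)] <= 2 ^+ n * c.
  apply: fxc => i; rewrite !ffunE -linearZ; exists ((2 ^- n)%:C *: x i) => //.
  by exists n => //; exists (x i).
move=> xn cn.
have := lt_le_trans xn fxc.
rewrite (_ : 4 = 2 * 2) ?exprMn ?ltr_pM2l// => [nc|]; last by rewrite -natrM.
have := lt_trans nc cn.
by rewrite -natrX ltr_nat ltnNge ltnW// ltn_expl.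
Qed.

Lemma mb_opP T : mb_op mE mF T <-> linear T /\ (mb_norm mE mF T < +oo)%E.
Proof.
split=> [Tb|[Tl Too]]; first by split; [case: Tb|exact: mb_norm_lty].
split=> // B /multi_boundedP[c c0 Bc].
have [f fT] := linear_lift Tl; rewrite {}fT {T Tl} in Too *.
have /fineK fK : mb_norm mE mF f \is a fin_num by rewrite ge0_fin_numE ?mb_norm_ge0.
(* The summand 1 keeps the bound strictly positive even when the norm of [f] is 0. *)
apply/multi_boundedP; exists (c * (fine (mb_norm mE mF f) + 1)).
  by rewrite mulr_gt0// ltr_wpDl// fine_ge0 ?mb_norm_ge0.
apply/mb_constP => k y yB.
have {}yB i : exists x, B x /\ f x = y i by have [x] := yB i; exists x.
have [x xP] := choice yB.
have ccK : c%:C * (c^-1)%:C = 1 :> R[i] by rewrite -rmorphM/= divff// gt_eqF.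
(* The rescaled tuple has its entries in c^-1 B, a set of constant at most 1. *)
pose z := [ffun i => (c^-1)%:C *: x i].
have -> : y = c%:C *: [ffun i => f (z i)].
  apply/ffunP => i; rewrite !ffunE linearZ/= scalerA ccK scale1r.
  by case: (xP i).
rewrite mnormZ (cabs_real (ltW c0)) ler_wpM2l ?(ltW c0)// ltW ?ltr_pwDr//.
rewrite -lee_fin fK.
have := mb_const_scale (c^-1)%:C Bc.
rewrite cabs_real ?invr_ge0 ?(ltW c0)// mulVf ?gt_eqF// => B1.
by apply: (mnorm_le_mb_norm _ B1) => i; rewrite ffunE; exists (x i) => //; case: (xP i).
Qed.

Lemma mb_norm_fin_num T : mb_op mE mF T -> mb_norm mE mF T \is a fin_num.
Proof. by move=> /mb_norm_lty; rewrite ge0_fin_numE ?mb_norm_ge0. Qed.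

Lemma mb_normD T S :
  (mb_norm mE mF (T + S)%R <= mb_norm mE mF T + mb_norm mE mF S)%E.
Proof.
apply: mb_norm_le => B k x B1 Bx.
have := leeD (mnorm_le_mb_norm T B1 Bx) (mnorm_le_mb_norm S B1 Bx).
apply: le_trans; rewrite -EFinD lee_fin; apply: le_trans (mnormD _ _ _).
rewrite le_eqVlt; apply/orP; left; apply/eqP.
by congr (mnorm _ _); apply/ffunP => i; rewrite !ffunE.
Qed.

Lemma mb_normZ_le (a : R[i]) T :
  (mb_norm mE mF (a *: T)%R <= (cabs a)%:E * mb_norm mE mF T)%E.
Proof.
apply: mb_norm_le => B k x B1 Bx.
have a0 : (0 <= (cabs a)%:E)%E by rewrite lee_fin cabs_ge0.
have := lee_wpmul2l a0 (mnorm_le_mb_norm T B1 Bx).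
apply: le_trans; rewrite -EFinM lee_fin -mnormZ.
rewrite le_eqVlt; apply/orP; left; apply/eqP.
by congr (mnorm _ _); apply/ffunP => i; rewrite !ffunE.
Qed.

(** For nonzero [a], the reverse inequality is [mb_normZ_le] with the scalar a^-1 applied to
    [a *: T]. For [a = 0] an infinite norm is harmless, as 0 times infinity is 0. *)
Lemma mb_normZ (a : R[i]) T :
  mb_norm mE mF (a *: T) = ((cabs a)%:E * mb_norm mE mF T)%E.
Proof.
apply/eqP; rewrite eq_le mb_normZ_le/=.
have [->|a0] := eqVneq a 0; first by rewrite cabs0 mul0e mb_norm_ge0.
have ca0 : 0 < cabs a by rewrite lt_def cabs_eq0 a0 cabs_ge0.
rewrite -lee_pdivlMl// -cabsV -{1}[T](scalerK a0).
exact: mb_normZ_le.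
Qed.

Lemma submod_closed_mb_op : submod_closed [in mb_op mE mF].
Proof.
split=> [|a T S]; rewrite !inE.
  apply/mb_opP; split; first by move=> a x y; rewrite scaler0 addr0.
  by rewrite -(scale0r 0) mb_normZ cabs0 mul0e.
move=> /mb_opP[Tl Too] /mb_opP[Sl Soo]; apply/mb_opP; split.
  by move=> b x y; rewrite /= !fctE Tl Sl; rewrite !scalerDr !scalerA mulrC addrACA.
apply: (le_lt_trans (mb_normD _ _)); rewrite lte_add_pinfty// mb_normZ.
by rewrite lte_mul_pinfty// lee_fin cabs_ge0.
Qed.

(** Normalise [x] and compare with the operator norm. This yields both the definiteness of the norm
    and pointwise Cauchy sequences. *)
Lemma rnorm_le_mb_norm T x : mb_op mE mF T ->
  rnorm (T x) <= fine (mb_norm mE mF T) * rnorm x.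
Proof.
move=> Tb; have Tfin := mb_norm_fin_num Tb; have [/linear_lift[f fT] _] := Tb.
rewrite {}fT in Tfin *.
have [->|x0] := eqVneq x 0.
  by rewrite linear0 /rnorm !normr0 mulr0.
have r0 : 0 < rnorm x by rewrite lt_def rnorm_eq0 x0 rnorm_ge0.
rewrite -ler_pdivrMr// mulrC -[(rnorm x)^-1]cabs_real ?invr_ge0 ?rnorm_ge0//.
rewrite -rnormZ -linearZ/= -lee_fin fineK// (le_trans _ (op_norm_le_mb_norm _))//.
apply: ereal_sup_ubound; exists ((rnorm x)^-1%:C *: x) => //=.
by rewrite rnormZ cabs_real ?invr_ge0 ?rnorm_ge0// mulVf ?gt_eqF.
Qed.

Lemma is_norm_on_mb_norm :
  is_norm_on (mb_op mE mF) (fun T => fine (mb_norm mE mF T)).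
Proof.
split=> [T _|T Tb T0|a T Tb|T S Tb Sb].
- by rewrite fine_ge0 ?mb_norm_ge0.
- apply/funext => x; apply/eqP; rewrite -rnorm_eq0 eq_le rnorm_ge0 andbT.
  by rewrite (le_trans (rnorm_le_mb_norm _ Tb))// T0 mul0r.
- by rewrite mb_normZ fineM// mb_norm_fin_num.
- have fD : (mb_norm mE mF T + mb_norm mE mF S)%E \is a fin_num.
    by rewrite fin_numD !mb_norm_fin_num.
  rewrite -fineD ?mb_norm_fin_num// fine_le ?mb_normD//.
  rewrite ge0_fin_numE ?mb_norm_ge0// (le_lt_trans (mb_normD _ _))//.
  by rewrite ltey_eq fD.
Qed.

End Operators.

(** * Convergence with real epsilons, and completeness *)

Lemma cvg_rnormP {R : realType} {V : normedModType R[i]} (u : nat -> V) (l : V) :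
  u @ \oo --> l <->
  (forall e : R, 0 < e -> \forall n \near \oo, rnorm (u n - l) < e).
Proof.
split=> [/cvgrPdist_lt ul e e0|ul].
  have := ul e%:C; rewrite ltcR => /(_ e0); apply: filterS => n.
  by rewrite normr_rnorm ltcR -rnormN opprB.
(* A positive element of [R[i]] is real, so real epsilons suffice. *)
apply/cvgrPdist_lt => e e0; have eR := RRe_real (gtr0_real e0).
move: e0; rewrite -eR ltcR => /ul; apply: filterS => n.
by rewrite normr_rnorm ltcR -rnormN opprB.
Qed.

Lemma cauchy_rnorm_cvg {R : realType} {V : completeNormedModType R[i]}
    (u : nat -> V) :
  (forall e : R, 0 < e -> exists n0 : nat, forall m n : nat,
    (n0 <= m)%N -> (n0 <= n)%N -> rnorm (u m - u n) < e) ->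
  exists l : V, u @ \oo --> l.
Proof.
move=> uC; suff /cauchy_cvg ul : cauchy (u @ \oo) by exists (lim (u @ \oo)).
apply: cauchy_exP => e e0; have eR := RRe_real (gtr0_real e0).
move: e0; rewrite -eR ltcR => /uC[n0 un0]; exists (u n0).
exists n0 => // n /= n0n.
by rewrite -ball_normE /ball_/= normr_rnorm ltcR un0.
Qed.

Section Completeness.
Context {R : realType} {E : normedModType R[i]} {F : completeNormedModType R[i]}.
Context (mE : multinorm E) (mF : multinorm F).

Lemma mb_op_complete (u : nat -> E -> F) : (forall n, mb_op mE mF (u n)) ->
  (forall e : R, 0 < e -> exists n0 : nat, forall m n : nat,
    (n0 <= m)%N -> (n0 <= n)%N -> fine (mb_norm mE mF (u m - u n)) < e) ->
  exists2 l, mb_op mE mF l &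
    fine (mb_norm mE mF (u n - l)) @[n --> \oo] --> (0 : R).
Proof.
move=> ub uC.
have ubB m n : mb_op mE mF (u m - u n).
  have := (submod_closed_mb_op mE mF).2 (- 1) (u n) (u m).
  by rewrite !inE scaleN1r addrC; apply; exact: ub.
have /choice[l ul] (x : E) : exists y : F, u ^~ x @ \oo --> y.
  apply: cauchy_rnorm_cvg => e e0; have x0 := rnorm_ge0 x.
  (* The summand 1 avoids a division by zero at [x = 0]. *)
  have [|n0 un0] := uC (e / (1 + rnorm x)); first by rewrite divr_gt0// ltr_pwDl.
  exists n0 => m n n0m n0n; apply: (le_lt_trans (rnorm_le_mb_norm x (ubB m n))).
  apply: (@le_lt_trans _ _ (fine (mb_norm mE mF (u m - u n)) * (1 + rnorm x))).
    by rewrite ler_wpM2l ?fine_ge0 ?mb_norm_ge0// lerDr.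
  by rewrite -ltr_pdivlMr ?un0// ltr_pwDl.
have llin : linear l.
  move=> a x y; apply: (@cvg_unique _ (@norm_hausdorff _ F) _ _ _ _ (ul _)).
  have -> : u ^~ (a *: x + y) = (fun n => a *: u n x + u n y).
    by apply/funext => n; have [uln _] := ub n; rewrite uln.
  by apply: cvgD (ul y); apply: cvgZ (ul x); exact: cvg_cst.
(* Stated in the extended reals, because [u n - l] is not yet known to have finite norm. *)
have uBl e : 0 < e -> exists n0 : nat, forall n : nat, (n0 <= n)%N ->
    (mb_norm mE mF (u n - l)%R <= e%:E)%E.
  move=> /uC[n0 un0]; exists n0 => n n0n; apply: mb_norm_le => B k x B1 Bx.
  rewrite lee_fin; apply/ler_addgt0Pr => d d0.
  have dk0 : 0 < d / k.+1%:R by rewrite divr_gt0.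
  have ulx : \forall m \near \oo,
      forall i : 'I_k, rnorm (u m (x i) - l (x i)) < d / k.+1%:R.
    by apply: filter_forall => i; have /cvg_rnormP := ul (x i); apply.
  (* [m] depends on the tuple and on [d], but [n0] does not: the bound on [u n - u m] is uniform
     over tuples, and the pointwise limit only has to absorb [d]. *)
  near \oo => m.
  have -> : [ffun i => (u n - l) (x i)] =
      [ffun i => (u n - u m) (x i)] + [ffun i => (u m - l) (x i)].
    by apply/ffunP => i; rewrite !ffunE /= !fctE addrA subrK.
  apply: (le_trans (mnormD _ _ _)); apply: lerD.
    apply: (@le_trans _ _ (fine (mb_norm mE mF (u n - u m)))).
      by rewrite -lee_fin fineK ?mb_norm_fin_num// (mnorm_le_mb_norm _ _ B1).
    by apply/ltW/un0 => //; near: m; exact: nbhs_infty_ge.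
  apply: mnorm_le_coord => // i; rewrite ffunE; apply: ltW; move: i.
  by near: m.
have lb : mb_op mE mF l.
  apply/mb_opP; split=> //; have [n0 /(_ _ (leqnn n0)) un0] := uBl 1 ltr01.
  have [_ uoo] := (mb_opP mE mF (u n0)).1 (ub n0).
  (* The limit differs from a multi-bounded operator by one of norm at most 1. *)
  rewrite (_ : l = u n0 + (-1) *: (u n0 - l)); last first.
    by rewrite scaleN1r opprB addrC subrK.
  apply: (le_lt_trans (mb_normD _ _ _ _)); rewrite lte_add_pinfty// mb_normZ.
  by rewrite lte_mul_pinfty ?lee_fin ?cabs_ge0// (le_lt_trans un0) ?ltry.
exists l => //; apply/cvgrPdist_le => e /uBl[n0 un0]; exists n0 => // n /= n0n.
rewrite sub0r normrN ger0_norm ?fine_ge0 ?mb_norm_ge0//.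
by move: (un0 n n0n) (mb_norm_ge0 mE mF (u n - l)); case: mb_norm.
Unshelve. all: by end_near. Qed.

Lemma is_banach_on_mb_op :
  is_banach_on (mb_op mE mF) (fun T => fine (mb_norm mE mF T)).
Proof.
split; [exact: submod_closed_mb_op|exact: is_norm_on_mb_norm|].
exact: mb_op_complete.
Qed.

End Completeness.

(** * Rank-one and nuclear operators *)

Section RankOneNuclear.
Context {R : realType} {E F : normedModType R[i]}.
Context (mE : multinorm E) (mF : multinorm F).

Lemma op_norm_ge0 (G : normedModType R[i]) (T : E -> G) : (0 <= op_norm T)%E.
Proof.
apply: (@le_trans _ _ (rnorm (T 0))%:E); first by rewrite lee_fin rnorm_ge0.
by apply: ereal_sup_ubound; exists 0 => //=; rewrite /rnorm normr0.
Qed.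

Lemma rnorm_le_op_norm (G : normedModType R[i]) (T : E -> G) x :
  rnorm x <= 1 -> ((rnorm (T x))%:E <= op_norm T)%E.
Proof. by move=> x1; apply: ereal_sup_ubound; exists x. Qed.

Lemma bounded_op_fin_num (G : normedModType R[i]) (T : E -> G) :
  bounded_op T -> op_norm T \is a fin_num.
Proof.
move=> [/linear_lift[f ->{T}] /linear_bounded_continuous/linear_boundedP].
move=> /pinfty_ex_gt0[r r0 fr]; rewrite ge0_fin_numE ?op_norm_ge0//.
(* The bound [r] lives in [R[i]]; being positive it is real, and its real part bounds the
   supremum. *)
have rR := RRe_real (gtr0_real r0).
apply: (le_lt_trans _ (ltry (complex.Re r))).
apply: ge_ereal_sup => _ [x /= x1 <-]; rewrite lee_fin.
have := fr x; rewrite -rR !normr_rnorm -rmorphM lecR => /le_trans; apply.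
by rewrite ler_piMr// -lecR rR ltW.
Qed.

Lemma op_norm_rank_one (y : F) (l : E -> R[i]^o) :
  op_norm (rank_one y l) = ((rnorm y)%:E * op_norm l)%E.
Proof.
rewrite /op_norm -ereal_supZl ?rnorm_ge0//; last first.
  by apply/set0P; exists (rnorm (l 0))%:E, 0 => //=; rewrite /rnorm normr0.
rewrite image_comp; congr ereal_sup; apply: eq_imagel => x _ /=.
by rewrite rnormZ -EFinM mulrC.
Qed.

Lemma mb_norm_rank_one_le (y : F) (l : E -> R[i]^o) : dual l ->
  (mb_norm mE mF (rank_one y l) <= (rnorm y)%:E * op_norm l)%E.
Proof.
move=> /bounded_op_fin_num lfin; apply: mb_norm_le => B k x B1 Bx.
rewrite -(fineK lfin) -EFinM lee_fin mulrC.
apply: le_trans (ler_wpM2l _ (mnorm_const_le mF k y)); last first.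
  by rewrite fine_ge0 ?op_norm_ge0.
rewrite (_ : finfun _ = [ffun i => l (x i) *: [ffun=> y] i]); last first.
  by apply/ffunP => i; rewrite !ffunE.
apply: mnorm_scale_le => [|i]; first by rewrite fine_ge0 ?op_norm_ge0.
(* Elements of [B] have norm at most 1, as seen on 1-tuples, so [op_norm l] bounds every
   coefficient. *)
rewrite -lee_fin fineK//; apply: (rnorm_le_op_norm l).
exact: rnorm_le_mb_const B1 (Bx i).
Qed.

Lemma mb_norm_rank_one (y : F) (l : E -> R[i]^o) : dual l ->
  mb_norm mE mF (rank_one y l) = ((rnorm y)%:E * op_norm l)%E.
Proof.
move=> ld; apply/eqP; rewrite eq_le mb_norm_rank_one_le//=.
by rewrite -op_norm_rank_one op_norm_le_mb_norm.
Qed.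

Lemma mb_op_rank_one (y : F) (l : E -> R[i]^o) :
  dual l -> mb_op mE mF (rank_one y l).
Proof.
move=> ld; apply/mb_opP; split.
  move=> a u v; case: ld => lin _; rewrite /rank_one lin scalerDl.
  by rewrite [a *: l u]/(a * l u) scalerA.
rewrite mb_norm_rank_one//.
by rewrite ltey_eq fin_numM// bounded_op_fin_num.
Qed.

(** The series converges in the operator norm, which does not directly control the multi-bounded
    norm of the remainder. On a fixed tuple it does suffice: the remainder is small at each entry,
    and the partial sum obeys the rank-one bounds. *)
Lemma mb_norm_le_nuclear_sum (T : E -> F) (y : nat -> F) (l : nat -> E -> R[i]^o) :
  nuclear_rep T y l -> (mb_norm mE mF T <= nuclear_sum y l)%E.
Proof.
move=> [ld _ /fine_cvgP[Sfin /cvgrPdist_lt SC]].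
have yl0 i : (0 <= (rnorm (y i))%:E * op_norm (l i))%E.
  by rewrite mule_ge0 ?op_norm_ge0// lee_fin rnorm_ge0.
apply: mb_norm_le => B k x B1 Bx; apply/lee_addgt0Pr => d d0.
have dk0 : 0 < d / k.+1%:R by rewrite divr_gt0.
have {}SC := SC _ dk0.
near \oo => n; pose S : E -> F := \sum_(0 <= i < n) rank_one (y i) (l i).
have -> : [ffun i => T (x i)] = [ffun i => S (x i)] + [ffun i => (T - S) (x i)].
  by apply/ffunP => i; rewrite !ffunE /= !fctE [RHS]addrC subrK.
apply: (@le_trans _ _ ((mF k [ffun i => S (x i)])%:E +
   (mF k [ffun i => (T - S) (x i)])%:E)%E); first by rewrite -EFinD lee_fin mnormD.
apply: leeD.
  apply: (le_trans (mnorm_le_mb_norm _ _ B1 Bx)).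
  (* The terms are nonnegative, so it is enough to stay below the n-th partial sum. *)
  apply: le_trans (nneseries_lim_ge n (fun i _ _ => yl0 i)).
  rewrite /S; elim/big_ind2: _ => [|U a V b Ua Vb|i _].
  - by rewrite -(scale0r 0) mb_normZ cabs0 mul0e.
  - by apply: (le_trans (mb_normD _ _ _ _)); exact: leeD.
  - exact: mb_norm_rank_one_le.
rewrite lee_fin; apply: mnorm_le_coord => // i; rewrite ffunE.
(* Since [fine] sends infinity to 0, smallness of the [fine] value means something only once
   finiteness is known; it holds for all large [n]. *)
have TSfin : op_norm (T - S) \is a fin_num by rewrite /S; near: n.
have : `|0 - fine (op_norm (T - S))| < d / k.+1%:R by rewrite /S; near: n.
rewrite sub0r normrN ger0_norm ?fine_ge0 ?op_norm_ge0// => /ltW.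
apply: le_trans; rewrite -lee_fin fineK//; apply: rnorm_le_op_norm.
exact: rnorm_le_mb_const B1 (Bx i).
Unshelve. all: by end_near. Qed.

Lemma nuclear_mb_op (T : E -> F) : nuclear T ->
  mb_op mE mF T /\ (mb_norm mE mF T <= nuclear_norm T)%E.
Proof.
move=> [[Tl _] [y [l Tyl]]]; split.
  apply/mb_opP; split=> //.
  by apply: (le_lt_trans (mb_norm_le_nuclear_sum Tyl)); case: Tyl.
apply: le_ereal_inf_tmp => _ [z [m [Tzm ->]]].
exact: mb_norm_le_nuclear_sum.
Qed.

End RankOneNuclear.

Unset Implicit Arguments.

Theorem theorem6p15 (R : realType)
    (E : normedModType R[i]) (F : completeNormedModType R[i])
    (mE : multinorm E) (mF : multinorm F) :
  [/\ (forall T : E -> F, mb_op mE mF T -> mb_norm mE mF T \is a fin_num)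
        /\ is_banach_on (mb_op mE mF) (fun T => fine (mb_norm mE mF T)),
      forall (l0 : E -> R[i]^o) (y0 : F), dual l0 ->
        [/\ mb_op mE mF (rank_one y0 l0),
            mb_norm mE mF (rank_one y0 l0) = ((rnorm y0)%:E * op_norm l0)%E
          & ((rnorm y0)%:E * op_norm l0)%E = op_norm (rank_one y0 l0)]
    & forall T : E -> F, nuclear T ->
        mb_op mE mF T /\ (mb_norm mE mF T <= nuclear_norm T)%E].
Proof.
split.
- by split=> [T|]; [exact: mb_norm_fin_num|exact: is_banach_on_mb_op].
- move=> l0 y0 ld; split; first exact: mb_op_rank_one.
    exact: mb_norm_rank_one.
  by rewrite op_norm_rank_one.
- exact: nuclear_mb_op.
Qed.
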